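(* In the $k$-dimensional homogeneous DRB game with exponent $\alpha>0$, for sufficiently large $n$ the optimal social welfare is $\Theta\!\left(\frac{n^{\alpha+k}}{\ln^{\alpha+1}n}\right)$.
   Context: Homogeneous DRB (Distance-Reciprocity Balanced) game. Fix an integer $k\ge 1$, $\gamma=1/g$ with $g\ge 2$ an integer, and a real $\alpha>0$. For an integer $n\ge 2$ let $V=\{1,\dots,n\}^k$, viewed as a torus grid with distance $d_M(u,v)=\sum_{i=1}^k\min\{|u_i-v_i|,\,n-|u_i-v_i|\}$. Each node $u\in V$ is a player with strategy $r_u\in\Sigma=\{0,\gamma,2\gamma,3\gamma,\dots\}$. For $r\ge 0$ let $c(r)=\sum_{v\ne u}d_M(u,v)^{-r}$ (independent of $u$) and $p_u(v,r)=d_M(u,v)^{-r}/c(r)$ for $v\neq u$. The payoff of $u$ under the strategy profile $\mathbf r=(r_v)_{v\in V}$ is $$\pi_u(\mathbf r)=\Big(\sum_{v\ne u}p_u(v,r_u)\,d_M(u,v)\Big)^{\alpha}\Big(\sum_{v\ne u}p_u(v,r_u)\,p_v(u,r_v)\Big)$$ (all players use the same exponent $\alpha$). The social welfare of $\mathbf r$ is $\sum_{u\in V}\pi_u(\mathbf r)$, and the optimal social welfare is its supremum over all profiles $\mathbf r\in\Sigma^V$. $\Theta(\cdot)$ is as $n\to\infty$, with hidden constants (and the threshold on $n$) depending only on $k,\gamma,\alpha$. *)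

(* Defs.v *)
From HB Require Import structures.
From mathcomp Require Import all_boot all_order all_algebra.
From mathcomp Require Import all_classical all_reals all_analysis.
Import Order.TTheory GRing.Theory Num.Theory.
Import numFieldNormedType.Exports.

Set Implicit Arguments.
Unset Strict Implicit.
Unset Printing Implicit Defensive.

Local Open Scope classical_set_scope.
Local Open Scope ring_scope.

(* The torus grid {1, ..., n}^k, with coordinates shifted to {0, ..., n - 1};
   the distance only involves coordinate differences. *)
Definition grid (k n : nat) : finType := {ffun 'I_k -> 'I_n}.

Definition torus_dist (k n : nat) (u v : grid k n) : nat :=
  (\sum_(i < k) minn `|u i - v i| (n - `|u i - v i|))%N.

Section DRB.
Context {R : realType} {k n : nat}.

(* The normalization c(r), written with its base node u, on which it does not
   depend by translation invariance. *)
Definition norm_const (u : grid k n) (r : R) : R :=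
  \sum_(v : grid k n | v != u) (torus_dist u v)%:R `^ (- r).

(* p_u(v, r); only meaningful, and only used, for v != u. *)
Definition link_prob (u v : grid k n) (r : R) : R :=
  (torus_dist u v)%:R `^ (- r) / norm_const u r.

Definition mean_dist (u : grid k n) (r : R) : R :=
  \sum_(v : grid k n | v != u) link_prob u v r * (torus_dist u v)%:R.

Definition reciprocity (r : grid k n -> R) (u : grid k n) : R :=
  \sum_(v : grid k n | v != u) link_prob u v (r u) * link_prob v u (r v).

Definition payoff (alpha : R) (r : grid k n -> R) (u : grid k n) : R :=
  mean_dist u (r u) `^ alpha * reciprocity r u.

Definition social_welfare (alpha : R) (r : grid k n -> R) : R :=
  \sum_(u : grid k n) payoff alpha r u.

End DRB.

(* Sigma = {0, gamma, 2 gamma, ...} *)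
Definition strategies {R : realType} (gamma : R) : set R :=
  range (fun m : nat => m%:R * gamma).

Definition profiles {R : realType} {k n : nat} (gamma : R) :
    set (grid k n -> R) :=
  [set r | forall u, strategies gamma (r u)].

(* [sup] is 0 on sets that are unbounded above, so a positive lower bound on
   this quantity entails that the welfare is bounded over all profiles. *)
Definition optimal_welfare {R : realType} (k : nat) (gamma alpha : R)
    (n : nat) : R :=
  sup [set social_welfare alpha r | r in @profiles R k n gamma].

(* Main.v *)
(* Write S(s) for the normalization c(s), so that the mean link distance of a
   node playing r is S(r - 1) / S(r), and L for ln n. Dyadic shells give
   S(s) = Theta(n^(k - s)) for s < k, S(k) = Theta(L), and S(k + 1) = O(1).

   Upper bound: let Q_u be the total probability of the links received by u; the
   Q_u add up to n^k. Since p_u(v, r) <= 1 / S(r), reciprocity is at most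
   Q_u / S(r_u), and trivially at most 1. If r_u = k, the mean distance is
   O(n / L) and pi_u = O(n^alpha / L^(alpha + 1)) Q_u. Otherwise r_u differs from
   k by at least gamma, and a power of n is lost: in 1 / S(r_u) = O(n^(- gamma))
   below k, in the mean distance O(n^(1 - gamma)) above k.

   Lower bound: if everyone played k, a link would be returned with probability
   1 / L, one factor L too few. Let instead the nodes whose first coordinate has
   one parity play k, and the others play k + 1. Every node of the first class
   has a neighbour in the second, which links back with probability bounded
   below; the parity is chosen so that the first class has at least half of the
   nodes, which avoids counting it. *)
Require Import Defs.
From HB Require Import structures.
From mathcomp Require Import all_boot all_order all_algebra.
From mathcomp Require Import all_classical all_reals all_analysis.
From mathcomp Require Import zify ring lra.
Import Order.TTheory GRing.Theory Num.Theory.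
Import numFieldNormedType.Exports.

Set Implicit Arguments.
Unset Strict Implicit.
Unset Printing Implicit Defensive.

Local Open Scope classical_set_scope.
Local Open Scope ring_scope.

(** * Counting on the cycle of length [n] *)

Definition cycle_dist (n : nat) (a b : 'I_n) : nat :=
  minn `|a - b| (n - `|a - b|).

Lemma cycle_distC n (a b : 'I_n) : cycle_dist a b = cycle_dist b a.
Proof. by rewrite /cycle_dist distnC. Qed.

(** The ball is covered by the [M] residues a + m and the [M] residues a - m. Repetitions in this
    list do no harm: only the enumeration of the ball must be duplicate-free. *)
Lemma card_cycle_ball n (a : 'I_n) (M : nat) :
  (#|[pred b | (cycle_dist a b < M)%N]| <= M.*2)%N.
Proof.
pose s := [seq (a + m) %% n | m <- iota 0 M]%N ++
  [seq (a + n - m) %% n | m <- iota 0 M]%N.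
rewrite cardE -(size_map val).
have -> : M.*2 = size s by rewrite size_cat !size_map size_iota addnn.
apply: uniq_leq_size; first by rewrite map_inj_uniq ?enum_uniq//; exact: val_inj.
move=> _ /mapP[b + ->]; rewrite mem_enum inE /cycle_dist => ab.
rewrite mem_cat -[val b]/(nat_of_ord b); apply/orP.
have := ltn_ord a; have := ltn_ord b; move: ab.
move: (nat_of_ord a) (nat_of_ord b) => x y xy yn xn.
have yE m : m = y \/ m = (y + n)%N -> (m %% n)%N = y.
  by case=> ->; rewrite ?modnDr modn_small.
(* The order of [x] and [y], and whether the direct arc is shorter than [M] or only the wrapping
   one, decide the list and the offset. *)
have [h|h] := leqP x y; have [h2|h2] := ltnP `|x - y|%N M.
- left; apply/mapP; exists (y - x)%N; rewrite ?mem_iota ?yE//; lia.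
- right; apply/mapP; exists (n - (y - x))%N; rewrite ?mem_iota ?yE//; lia.
- right; apply/mapP; exists (x - y)%N; rewrite ?mem_iota ?yE//; lia.
- left; apply/mapP; exists (n - (x - y))%N; rewrite ?mem_iota ?yE//; lia.
Qed.

(** This is (a + m) mod n for m < n, written as a case split that [lia] can treat. *)
Definition cycle_shift n (a : 'I_n) (m : nat) : nat :=
  if (a + m < n)%N then (a + m)%N else (a + m - n)%N.

Lemma cycle_shift_lt n (a : 'I_n) (m : nat) : (m < n)%N -> (cycle_shift a m < n)%N.
Proof. by rewrite /cycle_shift; have := ltn_ord a; case: ifPn; lia. Qed.

Lemma cycle_dist_shift n (a : 'I_n) (m : nat) (mn : (m < n)%N) :
  cycle_dist a (Ordinal (cycle_shift_lt a mn)) = minn m (n - m).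
Proof.
rewrite /cycle_dist /= /cycle_shift; have := ltn_ord a.
by case: ifPn => ? ?; rewrite /minn; do 2! case: ifPn; lia.
Qed.

Lemma cycle_sphere_gt0 n (a : 'I_n) (m : nat) : (0 < m)%N -> (m.*2 <= n)%N ->
  (0 < #|[pred b | cycle_dist a b == m]|)%N.
Proof.
move=> m0 mn; have mn' : (m < n)%N by lia.
apply/card_gt0P; exists (Ordinal (cycle_shift_lt a mn')).
by rewrite inE cycle_dist_shift; lia.
Qed.

Lemma card_cycle_ball_ge n (a : 'I_n) (m : nat) : (m.*2 <= n)%N ->
  (m <= #|[pred b | (cycle_dist a b <= m)%N]|)%N.
Proof.
move=> mn; rewrite -[leqLHS](size_iota 0 m) -(size_map (cycle_shift a)).
rewrite cardE -[leqRHS](size_map val); apply: uniq_leq_size.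
  rewrite map_inj_in_uniq ?iota_uniq// => x y.
  rewrite !mem_iota /cycle_shift => xm ym; have := ltn_ord a.
  by case: ifPn; case: ifPn; lia.
move=> _ /mapP[x + ->]; rewrite mem_iota => xm.
have xn : (x < n)%N by lia.
apply/mapP; exists (Ordinal (cycle_shift_lt a xn)) => //.
by rewrite mem_enum inE cycle_dist_shift; lia.
Qed.

(** * Balls, layers and neighbours in the torus *)

Section Torus.
Context {k n : nat}.
Implicit Types u v : grid k n.

Lemma torus_distE u v :
  torus_dist u v = (\sum_(i < k) cycle_dist (u i) (v i))%N.
Proof. by []. Qed.

Lemma torus_distC u v : torus_dist u v = torus_dist v u.
Proof. by rewrite !torus_distE; apply: eq_bigr => i _; rewrite cycle_distC. Qed.

Lemma cycle_dist_le_torus u v i : (cycle_dist (u i) (v i) <= torus_dist u v)%N.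
Proof. by rewrite torus_distE (bigD1 i)//= leq_addr. Qed.

Lemma torus_dist_le u v m : (forall i, cycle_dist (u i) (v i) <= m)%N ->
  (torus_dist u v <= k * m)%N.
Proof.
move=> um; rewrite torus_distE (@leq_trans (\sum_(i < k) m)%N)//.
  exact: leq_sum.
by rewrite sum_nat_const card_ord.
Qed.

Lemma torus_dist_le_diam u v : (torus_dist u v <= k * n)%N.
Proof. by apply: torus_dist_le => i; rewrite /cycle_dist; lia. Qed.

Lemma torus_dist_gt0 u v : v != u -> (0 < torus_dist u v)%N.
Proof.
apply: contraTT; rewrite -eqn0Ngt => /eqP uv0; rewrite negbK.
apply/eqP/ffunP => i; apply: val_inj => /=.
have := cycle_dist_le_torus u v i; rewrite uv0 /cycle_dist.
have := ltn_ord (u i); have := ltn_ord (v i).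
by move: (nat_of_ord (u i)) (nat_of_ord (v i)) => x y; lia.
Qed.

(** Torus balls lie in boxes and layers contain boxes, so counting reduces to the cycle, one
    coordinate at a time. *)
Lemma card_grid_family (F : 'I_k -> pred 'I_n) :
  #|[pred v : grid k n | [forall i, F i (v i)]]| = (\prod_(i < k) #|F i|)%N.
Proof.
have -> : (\prod_(i < k) #|F i|)%N = #|family F|.
  by rewrite card_family foldrE big_map big_enum.
apply: eq_card => v; rewrite !inE; exact: eq_forallb.
Qed.

Lemma card_torus_ball u (M : nat) :
  (#|[pred v : grid k n | (torus_dist u v < M)%N]| <= M.*2 ^ k)%N.
Proof.
pose F i : pred 'I_n := fun b => (cycle_dist (u i) b < M)%N.
apply: (@leq_trans #|[pred v : grid k n | [forall i, F i (v i)]]|).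
  apply: subset_leq_card; apply/fintype.subsetP => v; rewrite !inE => uv.
  by apply/forallP => i /=; exact: leq_ltn_trans (cycle_dist_le_torus u v i) uv.
rewrite card_grid_family -[in leqRHS](card_ord k) -prod_nat_const.
by apply: leq_prod => i _; exact: card_cycle_ball.
Qed.

(** A substitute for counting spheres: pinning coordinate [i0] at distance exactly [m] makes the
    layers disjoint for distinct [m], while the other coordinates range over balls of radius [m],
    which keeps the distance between m and k m. *)
Lemma card_torus_layer u (i0 : 'I_k) (m : nat) : (0 < m)%N -> (m.*2 <= n)%N ->
  (m ^ k.-1 <= #|[pred v : grid k n | (cycle_dist (u i0) (v i0) == m) &&
    [forall i, cycle_dist (u i) (v i) <= m]%N]|)%N.
Proof.
move=> m0 mn.
pose F i : pred 'I_n := fun b => (cycle_dist (u i) b <= m)%N &&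
  ((i == i0) ==> (cycle_dist (u i) b == m)).
apply: (@leq_trans #|[pred v : grid k n | [forall i, F i (v i)]]|); last first.
  apply: subset_leq_card; apply/fintype.subsetP => v; rewrite !inE => /forallP uv.
  apply/andP; split; first by have := uv i0; rewrite /F /= eqxx => /andP[].
  by apply/forallP => i; have /andP[] := uv i.
rewrite card_grid_family (bigD1 i0)//=.
have -> : (m ^ k.-1 = \prod_(i < k | i != i0) m)%N.
  by rewrite prod_nat_const cardC1 card_ord.
(* Coordinate [i0] has at least one choice, every other coordinate at least [m]. *)
rewrite -[leqLHS]mul1n; apply: leq_mul.
  apply: leq_trans (cycle_sphere_gt0 (u i0) m0 mn) _.
  apply: subset_leq_card; apply/fintype.subsetP => b; rewrite !inE => /eqP bm.
  by rewrite unfold_in bm leqnn !eqxx.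
apply: (big_ind2 leq) => [//|*|i ii0]; first exact: leq_mul.
apply: leq_trans (card_cycle_ball_ge (u i) mn) _.
apply: subset_leq_card; apply/fintype.subsetP => b; rewrite !inE => bm.
by rewrite unfold_in bm (negbTE ii0).
Qed.

Lemma card_grid_neq u : #|[pred v | v != u]| = (n ^ k).-1.
Proof. by rewrite cardC1 card_ffun !card_ord. Qed.

Lemma torus_neighbor (i0 : 'I_k) u : (2 <= n)%N ->
  exists v, [/\ v != u, torus_dist u v = 1%N & odd (v i0) != odd (u i0)].
Proof.
move=> n2.
(* Step down, except at 0: wrapping from 0 to n - 1 would preserve the parity when [n] is odd. *)
pose b := if (u i0 == 0 :> nat)%N then 1%N else (u i0).-1.
have bn : (b < n)%N by rewrite /b; have := ltn_ord (u i0); case: ifPn; lia.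
pose v : grid k n := [ffun i => if i == i0 then Ordinal bn else u i].
have vi0 : v i0 = Ordinal bn by rewrite ffunE eqxx.
have par : odd (v i0) != odd (u i0).
  rewrite vi0 /= /b; by case: (nat_of_ord (u i0)) => //= m; case: (odd m).
exists v; split=> //; first by apply: contra par => /eqP ->.
rewrite torus_distE (bigD1 i0)//= big1 ?addn0 => [|i ii0].
  rewrite vi0 /cycle_dist /= /b.
  by have := ltn_ord (u i0); case: ifPn => /eqP/=; lia.
by rewrite ffunE (negbTE ii0) /cycle_dist distnn min0n.
Qed.

End Torus.

(** * Dyadic and harmonic bounds on the normalization S(s) *)

Section NormConst.
Context {R : realType} {k n : nat}.
Implicit Types (u v : grid k n) (r s t : R).

Lemma torus_dist_ge1 u v : v != u -> 1 <= (torus_dist u v)%:R :> R.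
Proof. by move=> vu; rewrite ler1n torus_dist_gt0. Qed.

Lemma norm_const_ge0 u r : 0 <= norm_const u r.
Proof. by apply: sumr_ge0 => v _; exact: powR_ge0. Qed.

Lemma norm_const_anti u s t : s <= t -> norm_const u t <= norm_const u s.
Proof.
move=> st; apply: ler_sum => v vu.
by apply: ler_powR; rewrite ?torus_dist_ge1// lerN2.
Qed.

Lemma mean_distE u r : mean_dist u r = norm_const u (r - 1) / norm_const u r.
Proof.
rewrite /mean_dist /norm_const mulr_suml; apply: eq_bigr => v vu.
have d0 : 0 < (torus_dist u v)%:R :> R by rewrite ltr0n torus_dist_gt0.
rewrite /link_prob opprB addrC powRD ?powRr1 ?(ltW d0)//; first by rewrite mulrAC.
by apply/implyP => _; rewrite gt_eqF.
Qed.

(** Each of the n^k - 1 terms is at least the value at distance k n, which bounds the diameter. *)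
Lemma norm_const_ge_diam u s : (0 < n)%N -> 0 <= s ->
  (n ^ k).-1%:R * (k * n)%:R `^ (- s) <= norm_const u s.
Proof.
move=> n0 s0; rewrite -(card_grid_neq u) mulr_natl -sumr_const.
rewrite /norm_const; apply: ler_sum => v; rewrite inE => vu.
have d0 := torus_dist_gt0 vu.
rewrite !powRN lef_pV2 ?posrE ?powR_gt0 ?ltr0n//; last first.
  exact: leq_trans d0 (torus_dist_le_diam u v).
by apply: ge0_ler_powR; rewrite ?nnegrE ?ler0n ?ler_nat ?torus_dist_le_diam.
Qed.

Lemma norm_const_ge1 (i0 : 'I_k) u s : (2 <= n)%N -> 1 <= norm_const u s.
Proof.
move=> n2; have [v [vu uv1 _]] := torus_neighbor i0 u n2.
rewrite /norm_const (bigD1 v)//= uv1 powR1 lerDl.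
by apply: sumr_ge0 => w _; exact: powR_ge0.
Qed.

(* Grouping the nodes by dyadic distance [2^j <= d < 2^(j+1)], each shell lies
   in a ball of at most [2^(k (j+2))] nodes. *)
Lemma norm_const_le_dyadic u s : 0 <= s ->
  norm_const u s <=
    4 ^+ k * \sum_(j < (trunc_log 2 (k * n)).+1) (2 `^ (k%:R - s)) ^+ j.
Proof.
move=> s0; set J := trunc_log _ _.
pose a (j : nat) : R := (2 ^ j)%:R `^ (- s).
(* The term of [v] is charged to j = [trunc_log 2] of its distance. Only the outer radius of the
   shell is kept as a condition, so that summand j runs over a ball. *)
apply: (@le_trans _ _ (\sum_(v : grid k n | v != u) \sum_(j < J.+1)
    (if (torus_dist u v < 2 ^ j.+1)%N then a j else 0))).
  apply: ler_sum => v vu.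
  have d0 := torus_dist_gt0 vu.
  have jJ : (trunc_log 2 (torus_dist u v) < J.+1)%N.
    by rewrite ltnS leq_trunc_log// torus_dist_le_diam.
  rewrite (bigD1 (Ordinal jJ))//= trunc_log_ltn//.
  apply: ler_wpDr.
    by apply: sumr_ge0 => j _; case: ifP => // _; exact: powR_ge0.
  rewrite /a !powRN lef_pV2 ?posrE ?powR_gt0 ?ltr0n ?expn_gt0//.
  by apply: ge0_ler_powR; rewrite ?nnegrE ?ler0n ?ler_nat ?trunc_logP.
rewrite exchange_big/= mulr_sumr; apply: ler_sum => j _.
rewrite -big_mkcondr/=.
apply: (@le_trans _ _ (((2 ^ j.+1).*2 ^ k)%:R * a j)).
  rewrite sumr_const -[leLHS]mulr_natl ler_wpM2r ?powR_ge0// ler_nat.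
  apply: leq_trans (card_torus_ball u (2 ^ j.+1)).
  by apply: subset_leq_card; apply/fintype.subsetP => v; rewrite !inE => /andP[].
rewrite /a le_eqVlt; apply/orP; left; apply/eqP.
have -> : ((2 ^ j.+1).*2 ^ k)%N = (4 ^ k * (2 ^ j) ^ k)%N.
  by rewrite -expnMn; congr (_ ^ k)%N; rewrite expnS -muln2; lia.
rewrite natrM -mulrA natrX; congr (_ * _).
rewrite natrX -powR_mulrn ?ler0n// -[in RHS]powR_mulrn ?powR_ge0//.
rewrite natrX -!powR_mulrn ?ler0n// -powRrM -powRrM -powRrM -powRD.
  by congr (_ `^ _); ring.
by rewrite pnatr_eq0 implybT.
Qed.

Lemma ln_succ_le_harmonic (M : nat) :
  ln (M.+1%:R : R) <= \sum_(1 <= m < M.+1) m%:R^-1.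
Proof.
elim: M => [|M IH]; first by rewrite ln1 big_geq.
rewrite big_nat_recr//=.
have -> : (M.+2%:R = M.+1%:R * (1 + M.+1%:R^-1) :> R).
  by rewrite mulrDr mulr1 divff// natr1.
rewrite lnM ?posrE ?addr_gt0 ?invr_gt0 ?ltr0n// lerD//.
apply: le_ln1Dx; apply: lt_trans (ltrN10 R) _.
by rewrite invr_gt0 ltr0n.
Qed.

(** The layer at distance m in one coordinate has at least m^(k-1) nodes at distance at most k m,
    hence contributes at least 1 / (k^k m). Summing over 1 <= m <= n/2 gives a harmonic sum. *)
Lemma norm_const_dim_ge u : (0 < k)%N -> (0 < n)%N ->
  ln (n%:R : R) / (2 * k%:R ^+ k) <= norm_const u k%:R.
Proof.
move=> k0 n0; pose i0 := Ordinal k0.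
(* The factor 2 comes from n <= (floor(n/2) + 1)^2. *)
have lnS : ln (n%:R : R) / 2 <= ln (n./2.+1%:R : R).
  rewrite ler_pdivrMr// mulrC mulr_natl -lnXn ?ltr0n// ler_ln ?posrE ?exprn_gt0 ?ltr0n//.
  rewrite -natrX ler_nat -[leqLHS](odd_double_half n) expnS expn1.
  by case: (odd n); nia.
rewrite invfM mulrA; apply: (@le_trans _ _
    ((\sum_(1 <= m < n./2.+1) m%:R^-1) / k%:R ^+ k)).
  rewrite ler_wpM2r ?invr_ge0 ?exprn_ge0 ?ler0n//.
  exact: le_trans lnS (ln_succ_le_harmonic _).
have dn v : (cycle_dist (u i0) (v i0) < n.+1)%N by rewrite /cycle_dist; lia.
rewrite /norm_const (partition_big (fun v => Ordinal (dn v)) predT)//=.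
have -> : \sum_(1 <= m < n./2.+1) m%:R^-1 =
    \sum_(m < n.+1 | (0 < m <= n./2)%N) m%:R^-1 :> R.
  rewrite (big_nat_widen 1 _ n.+1); last by lia.
  rewrite (big_nat_widenl 1 0)// big_mkord.
  by apply: eq_bigl => m; rewrite ltnS andbC.
rewrite mulr_suml [leLHS]big_mkcond; apply: ler_sum => m _.
case: ifP => [/andP[m0 mn]|_]; last by apply: sumr_ge0 => v _; exact: powR_ge0.
pose A := [pred v : grid k n | (cycle_dist (u i0) (v i0) == m) &&
    [forall i, cycle_dist (u i) (v i) <= m]%N].
have Am : (m ^ k.-1 <= #|A|)%N by apply: card_torus_layer => //; lia.
apply: (@le_trans _ _ (\sum_(v in A) ((k * m)%:R ^+ k)^-1)).
  rewrite sumr_const -[leRHS]mulr_natl.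
  apply: (@le_trans _ _ ((m ^ k.-1)%:R * ((k * m)%:R ^+ k)^-1)); last first.
    by rewrite ler_wpM2r ?ler_nat// invr_ge0 exprn_ge0.
  rewrite natrM exprMn natrX invfM [leRHS]mulrCA [leLHS]mulrC ler_wpM2l//.
  rewrite -{2}(prednK k0) exprS invfM mulrCA divff ?mulr1//.
  by rewrite expf_neq0// pnatr_eq0 -lt0n.
rewrite big_mkcond [leRHS]big_mkcond; apply: ler_sum => v _.
case: ifP => [|_]; last by case: ifP => // _; exact: powR_ge0.
rewrite inE => /andP[/eqP uvm /forallP uv].
have vu : v != u.
  by apply: contraTneq m0 => vu; rewrite -uvm vu /cycle_dist distnn min0n.
rewrite vu /= -val_eqE /= uvm eqxx powR_invn//.
have d0 := torus_dist_gt0 vu.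
rewrite lef_pV2 ?posrE ?exprn_gt0 ?ltr0n ?muln_gt0 ?k0//.
by rewrite lerXn2r ?nnegrE ?ler0n// ler_nat torus_dist_le.
Qed.
End NormConst.

(** * Growth of S(s) below, at and above the dimension *)

Section Estimates.
Context {R : realType}.

Lemma geometric_sum_le (q : R) (J : nat) : 1 < q ->
  \sum_(j < J.+1) q ^+ j <= q / (q - 1) * q ^+ J.
Proof.
move=> q1; have q10 : 0 < q - 1 by rewrite subr_gt0.
rewrite mulrAC ler_pdivlMr// mulrC -subrX1 exprS.
by rewrite gerBl.
Qed.

(** Apply ln y < y to y = x^(e/p) and raise to the power p. Any positive power of n thus absorbs any
    power of ln n. *)
Lemma ln_powR_le (p e x : R) : 0 < p -> 0 < e -> 1 <= x ->
  ln x `^ p <= (p / e) `^ p * x `^ e.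
Proof.
move=> p0 e0 x1; have x0 : 0 < x by exact: lt_le_trans x1.
have pe0 : 0 < p / e by rewrite divr_gt0.
have lnx : ln x <= p / e * x `^ (e / p).
  rewrite -[leLHS](mulVKf (lt0r_neq0 pe0)) ler_pM2l// invf_div -ln_powR.
  by apply: ltW; apply: ln_sublinear; exact: powR_gt0.
apply: (@le_trans _ _ ((p / e * x `^ (e / p)) `^ p)).
  by apply: ge0_ler_powR; rewrite ?nnegrE ?ln_ge0 ?(ltW p0)// mulr_ge0 ?powR_ge0 ?ltW.
by rewrite powRM ?powR_ge0 ?(ltW pe0)// -powRrM divfK ?gt_eqF.
Qed.

(** For s < k the dyadic sum is geometric with ratio 2^(k-s) > 1, so its last term dominates, and
    2^J <= k n. *)
Lemma norm_const_le_powR (k : nat) (s : R) : (0 < k)%N -> 0 <= s < k%:R ->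
  exists2 C : R, 0 < C & forall n (u : grid k n), (0 < n)%N ->
    norm_const u s <= C * n%:R `^ (k%:R - s).
Proof.
move=> k0 /andP[s0 sk]; set e := k%:R - s.
have e0 : 0 < e by rewrite subr_gt0.
have q1 : 1 < 2 `^ e :> R.
  by rewrite -[ltLHS](powRr0 2) /powR !gt_eqF// ltr_expR ltr_pM2r ?ln_gt0 ?ltr1n.
exists (4 ^+ k * (2 `^ e / (2 `^ e - 1) * k%:R `^ e)).
  by rewrite !mulr_gt0 ?exprn_gt0 ?invr_gt0 ?subr_gt0 ?powR_gt0 ?ltr0n.
move=> n u n0; apply: le_trans (norm_const_le_dyadic u s0) _.
rewrite -/e -mulrA ler_pM2l ?exprn_gt0//.
apply: le_trans (geometric_sum_le _ q1) _.
rewrite -[leRHS]mulrA ler_pM2l ?divr_gt0 ?subr_gt0 ?powR_gt0//.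
rewrite -powRM ?ler0n// -powR_mulrn ?powR_ge0// powRAC powR_mulrn//.
apply: ge0_ler_powR; rewrite ?nnegrE ?exprn_ge0 ?mulr_ge0// ?(ltW e0)//.
by rewrite -natrX -natrM ler_nat trunc_logP// muln_gt0 k0.
Qed.

Lemma norm_const_ge_powR (k : nat) (s : R) : (0 < k)%N -> 0 <= s ->
  exists2 c : R, 0 < c & forall n (u : grid k n), (2 <= n)%N ->
    c * n%:R `^ (k%:R - s) <= norm_const u s.
Proof.
(* The 1/2 comes from n^k - 1 >= n^k / 2. *)
move=> k0 s0; exists (k%:R `^ (- s) / 2); first by rewrite divr_gt0 ?powR_gt0 ?ltr0n.
move=> n u n2; have n0 : (0 < n)%N by lia.
apply: le_trans (norm_const_ge_diam u n0 s0).
rewrite natrM powRM ?ler0n// powRD; last by rewrite pnatr_eq0 -lt0n n0 implybT.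
rewrite [leRHS]mulrCA -[leLHS]mulrA ler_pM2l ?powR_gt0 ?ltr0n//.
rewrite mulrA ler_wpM2r ?powR_ge0// powR_mulrn// mulrC ler_pdivrMr//.
rewrite -natrX -natrM ler_nat.
have : (2 <= n ^ k)%N by apply: leq_trans n2 _; rewrite -{1}(expn1 n) leq_pexp2l.
by lia.
Qed.

(** At s = k every dyadic term is 1, so the sum merely counts the O(ln n) shells. *)
Lemma norm_const_dim_le (k : nat) : (0 < k)%N ->
  exists2 C : R, 0 < C & forall n (u : grid k n), (2 <= n)%N ->
    norm_const u k%:R <= C * ln n%:R.
Proof.
move=> k0; have ln2 : 0 < ln 2 :> R by rewrite ln_gt0 ?ltr1n.
(* Chosen so that A ln n dominates J + 1: 2^J <= k n bounds J, and ln n / ln 2 >= 1 absorbs the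
   terms 1 and ln k. *)
pose A : R := (ln k%:R / ln 2 + 1) / ln 2 + 1 / ln 2.
have lnk : 0 <= ln k%:R :> R by rewrite ln_ge0// ler1n.
have A0 : 0 < A.
  by rewrite addr_gt0 ?divr_gt0// ltr_wpDl ?divr_ge0 ?(ltW ln2).
exists (4 ^+ k * A); first by rewrite mulr_gt0 ?exprn_gt0.
move=> n u n2; have n0 : (0 < n)%N by lia.
apply: le_trans (norm_const_le_dyadic u (ler0n _ _)) _.
rewrite -mulrA ler_pM2l ?exprn_gt0// subrr powRr0.
under eq_bigr do rewrite expr1n.
rewrite sumr_const card_ord; set J := trunc_log _ _.
have lnn : ln 2 <= ln n%:R :> R by rewrite ler_ln ?posrE ?ltr0n// ler_nat.
have Jle : J%:R * ln 2 <= ln k%:R + ln n%:R :> R.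
  rewrite mulr_natl -lnXn// -lnM ?posrE ?ltr0n// -natrX -natrM.
  by rewrite ler_ln ?posrE ?ltr0n ?muln_gt0 ?k0 ?n0 ?expn_gt0// ler_nat trunc_logP// muln_gt0 k0.
rewrite -natr1 /A.
have q1 : 1 <= ln n%:R / ln 2 :> R by rewrite ler_pdivlMr ?mul1r.
have J1 : J%:R <= (ln k%:R + ln n%:R) / ln 2 :> R by rewrite ler_pdivlMr.
apply: le_trans (lerD J1 q1) _.
have -> : ((ln k%:R / ln 2 + 1) / ln 2 + 1 / ln 2) * ln n%:R =
   (ln k%:R * (ln n%:R / ln 2) + ln n%:R) / ln 2 + ln n%:R / ln 2 :> R.
  by field; rewrite gt_eqF.
rewrite lerD2r ler_wpM2r ?invr_ge0 ?(ltW ln2)// lerD2r.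
by rewrite ler_peMr.
Qed.

(** The dyadic ratio is now 1/2, and the sum stays below 2 for every [n]. *)
Lemma norm_const_dimS_le (k n : nat) (u : grid k n) :
  norm_const u (k.+1%:R : R) <= 4 ^+ k * 2.
Proof.
apply: le_trans (norm_const_le_dyadic u (ler0n _ _)) _.
rewrite ler_pM2l ?exprn_gt0//.
have -> : k%:R - k.+1%:R = -1 :> R by rewrite -natr1; ring.
rewrite powR_inv1//; set J := trunc_log _ _.
have -> : \sum_(j < J.+1) 2^-1 ^+ j = 2 - 2 * 2^-1 ^+ J.+1 :> R.
  elim: J => [|J IH]; first by rewrite big_ord1; field.
  by rewrite big_ord_recr/= IH !exprS; field.
by rewrite gerBl mulr_ge0// exprn_ge0// invr_ge0.
Qed.
End Estimates.

(** * Links, reciprocity and payoffs of a given profile *)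

Section Links.
Context {R : realType} {k n : nat} (k0 : (0 < k)%N) (n2 : (2 <= n)%N).
Implicit Types (u v : grid k n) (s : R) (r : grid k n -> R).

Definition incoming r u : R := \sum_(v : grid k n | v != u) link_prob v u (r v).

Lemma norm_const_gt0 u s : 0 < norm_const u s.
Proof. exact: lt_le_trans ltr01 (norm_const_ge1 (Ordinal k0) u s n2). Qed.

Lemma link_prob_ge0 u v s : 0 <= link_prob u v s.
Proof. by rewrite divr_ge0 ?powR_ge0 ?norm_const_ge0. Qed.

Lemma incoming_ge0 r u : 0 <= incoming r u.
Proof. by apply: sumr_ge0 => v _; exact: link_prob_ge0. Qed.

Lemma link_prob_sum u s : \sum_(v : grid k n | v != u) link_prob u v s = 1.
Proof. by rewrite -mulr_suml divff// lt0r_neq0// norm_const_gt0. Qed.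

Lemma link_prob_le u v s : 0 <= s -> v != u -> link_prob u v s <= (norm_const u s)^-1.
Proof.
move=> s0 vu; rewrite -[leRHS]mul1r ler_wpM2r ?invr_ge0 ?norm_const_ge0//.
rewrite powRN invf_le1 ?powR_gt0 ?ltr0n ?torus_dist_gt0//.
by rewrite -[leLHS](powRr0 (torus_dist u v)%:R); apply: ler_powR; rewrite ?torus_dist_ge1.
Qed.

Lemma link_prob_le1 u v s : v != u -> link_prob u v s <= 1.
Proof.
move=> vu; rewrite -(link_prob_sum u s) (bigD1 v)//= lerDl.
by apply: sumr_ge0 => w _; exact: link_prob_ge0.
Qed.

(** Double counting: every node emits links of total probability 1. *)
Lemma sum_incoming r : \sum_(u : grid k n) incoming r u = (n ^ k)%:R.
Proof.
rewrite /incoming (exchange_big_dep predT)//=.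
transitivity (\sum_(v : grid k n) (1 : R)).
  apply: eq_bigr => v _; rewrite -[RHS](link_prob_sum v (r v)).
  by apply: eq_bigl => u; rewrite eq_sym.
by rewrite sumr_const card_ffun !card_ord.
Qed.

Lemma reciprocity_ge0 r u : 0 <= reciprocity r u.
Proof. by apply: sumr_ge0 => v _; rewrite mulr_ge0 ?link_prob_ge0. Qed.

Lemma reciprocity_le_incoming r u : 0 <= r u ->
  reciprocity r u <= (norm_const u (r u))^-1 * incoming r u.
Proof.
move=> ru; rewrite mulr_sumr; apply: ler_sum => v vu.
by rewrite ler_wpM2r ?link_prob_ge0 ?link_prob_le.
Qed.

Lemma reciprocity_le1 r u : reciprocity r u <= 1.
Proof.
rewrite -(link_prob_sum u (r u)); apply: ler_sum => v vu.
by rewrite ler_piMr ?link_prob_ge0 ?link_prob_le1// eq_sym.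
Qed.

Lemma mean_dist_ge0 u s : 0 <= mean_dist u s.
Proof. by apply: sumr_ge0 => v _; rewrite mulr_ge0 ?link_prob_ge0. Qed.

Lemma mean_dist_le_diam u s : mean_dist u s <= (k * n)%:R.
Proof.
rewrite -[leRHS]mul1r -[X in X * _](link_prob_sum u s) mulr_suml; apply: ler_sum => v vu.
by rewrite ler_wpM2l ?link_prob_ge0// ler_nat torus_dist_le_diam.
Qed.

Lemma payoff_ge0 alpha r u : 0 <= payoff alpha r u.
Proof. by rewrite mulr_ge0 ?powR_ge0 ?reciprocity_ge0. Qed.

(** Charging the payoff to [incoming] instead of bounding it node by node lets [sum_incoming]
    control the sum over [u]. This serves strategies at most k, where 1 / S(r_u) is small. *)
Lemma payoff_le_incoming alpha r u (m c : R) : 0 <= alpha -> 0 <= r u ->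
  mean_dist u (r u) <= m -> 0 < c -> c <= norm_const u (r u) ->
  payoff alpha r u <= m `^ alpha / c * incoming r u.
Proof.
move=> a0 ru um c0 uc; rewrite -mulrA; apply: ler_pM.
- exact: powR_ge0.
- exact: reciprocity_ge0.
- apply: ge0_ler_powR => //; rewrite nnegrE ?mean_dist_ge0//.
  exact: le_trans (mean_dist_ge0 _ _) um.
apply: le_trans (reciprocity_le_incoming ru) _.
by rewrite ler_wpM2r ?incoming_ge0// lef_pV2 ?posrE ?norm_const_gt0.
Qed.
End Links.

(** Source of the exponent alpha + 1: the mean distance contributes alpha powers of 1 / ln n, and 1
    / S(k) one more. *)
Lemma powR_div_ln (R : realType) (a b x : R) : 0 <= x -> 1 < b ->
  (x / ln b) `^ a / ln b = x `^ a / ln b `^ (a + 1).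
Proof.
move=> x0 b1; have L0 := ln_gt0 b1.
rewrite powRM ?invr_ge0 ?(ltW L0)// powRD; last by rewrite (gt_eqF L0) implybT.
have -> : (ln b)^-1 `^ a = (ln b `^ a)^-1.
  by rewrite -[in LHS]powR_inv1 ?(ltW L0)// -powRrM mulN1r powRN.
by rewrite powRr1 ?(ltW L0)// invfM mulrA.
Qed.

(** * Upper bound on the welfare, by strategies below, at and above k *)

Section Bounds.
Context {R : realType} {k : nat} (k0 : (0 < k)%N) (alpha : R) (a0 : 0 < alpha).

(** The target rate divided by n^k, that is, the rate per node. *)
Definition welfare_scale (n : nat) : R := n%:R `^ alpha / ln n%:R `^ (alpha + 1).

Lemma welfare_scale_ge0 n : 0 <= welfare_scale n.
Proof. by rewrite divr_ge0 ?powR_ge0. Qed.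

Lemma ln_nat_gt0 n : (2 <= n)%N -> 0 < ln n%:R :> R.
Proof. by move=> n2; rewrite ln_gt0 ?ltr1n. Qed.

Lemma powRN_le_ln (p e : R) : 0 < p -> 0 < e ->
  exists2 C : R, 0 < C & forall n, (2 <= n)%N ->
    n%:R `^ (- e) <= C / ln n%:R `^ p.
Proof.
move=> p0 e0; exists ((p / e) `^ p); first by rewrite powR_gt0 ?divr_gt0.
move=> n n2; have n0 : (0 < n)%N by lia.
rewrite ler_pdivlMr ?powR_gt0 ?ln_nat_gt0// powRN mulrC ler_pdivrMr ?powR_gt0 ?ltr0n//.
by apply: ln_powR_le => //; rewrite ler1n.
Qed.

(** The mean distance is only bounded by k n. By monotonicity S(r_u) >= S(k - e) >= c n^e, and the
    factor n^(-e) beats the logarithms. *)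
Lemma payoff_le_subcritical (e : R) : 0 < e <= 1 ->
  exists2 K : R, 0 < K & forall n (r : grid k n -> R) u, (2 <= n)%N ->
    0 <= r u <= k%:R - e -> payoff alpha r u <= K * welfare_scale n * incoming r u.
Proof.
move=> /andP[e0 e1].
have s0 : 0 <= k%:R - e by rewrite subr_ge0 (le_trans e1)// ler1n.
have [c c0 cS] := norm_const_ge_powR k0 s0.
have [C C0 CL] := powRN_le_ln (addr_gt0 a0 ltr01) e0.
exists (k%:R `^ alpha * C / c); first by rewrite !mulr_gt0 ?invr_gt0 ?powR_gt0 ?ltr0n.
move=> n r u n2 /andP[ru0 ru]; have n0 : (0 < n)%N by lia.
have ce : 0 < c * n%:R `^ e by rewrite mulr_gt0 ?powR_gt0 ?ltr0n.
have Sru : c * n%:R `^ e <= norm_const u (r u).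
  apply: le_trans (norm_const_anti u ru); have := cS n u n2.
  by rewrite subKr.
apply: le_trans (payoff_le_incoming k0 n2 (ltW a0) ru0 (mean_dist_le_diam k0 n2 _ _) ce Sru) _.
rewrite ler_wpM2r ?incoming_ge0// natrM powRM// invfM -powRN.
rewrite [leLHS](_ : _ = k%:R `^ alpha / c * n%:R `^ alpha * n%:R `^ (- e)); last by ring.
rewrite [leRHS](_ : _ = k%:R `^ alpha / c * n%:R `^ alpha * (C / ln n%:R `^ (alpha + 1))).
  by rewrite ler_wpM2l ?CL// !mulr_ge0 ?invr_ge0 ?powR_ge0 ?ltW.
by rewrite /welfare_scale; ring.
Qed.

Lemma payoff_le_critical :
  exists2 K : R, 0 < K & forall n (r : grid k n -> R) u, (2 <= n)%N ->
    r u = k%:R -> payoff alpha r u <= K * welfare_scale n * incoming r u.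
Proof.
pose c : R := (2 * k%:R ^+ k)^-1.
have c0 : 0 < c by rewrite invr_gt0 mulr_gt0 ?exprn_gt0 ?ltr0n.
have k1 : 1 <= k%:R :> R by rewrite ler1n.
have s0 : 0 <= (k%:R - 1 : R) < k%:R by apply/andP; split; lra.
have [C C0 CS] := norm_const_le_powR k0 s0.
(* From S(k - 1) <= C n and S(k) >= c ln n, the mean distance is at most (C / c) n / ln n; the last
   1 / c comes from reciprocity. *)
exists ((C / c) `^ alpha / c); first by rewrite divr_gt0 ?powR_gt0 ?divr_gt0.
move=> n r u n2 ru; have n0 : (0 < n)%N by lia.
have L0 : 0 < ln n%:R :> R by exact: ln_nat_gt0.
have ru0 : 0 <= r u by rewrite ru ler0n.
have cL0 : 0 < c * ln n%:R by rewrite mulr_gt0.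
have Sru : c * ln n%:R <= norm_const u (r u).
  by rewrite ru mulrC norm_const_dim_ge.
have mru : mean_dist u (r u) <= C / c * (n%:R / ln n%:R).
  rewrite mean_distE mulrACA -invfM ler_pM ?invr_ge0 ?norm_const_ge0//.
    by have := CS n u n0; rewrite subKr powRr1// ru.
  by rewrite lef_pV2 ?posrE ?norm_const_gt0.
apply: le_trans (payoff_le_incoming k0 n2 (ltW a0) ru0 mru cL0 Sru) _.
rewrite ler_wpM2r ?incoming_ge0// powRM ?divr_ge0 ?(ltW C0) ?(ltW c0) ?(ltW L0)//.
rewrite /welfare_scale -powR_div_ln ?ltr1n// invfM.
by rewrite le_eqVlt; apply/orP; left; apply/eqP; ring.
Qed.

(** Since S(r_u) >= 1, the mean distance is at most S(r_u - 1) <= S(k + e - 1) = O(n^(1 - e)). The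
    lost n^(- e alpha) absorbs the logarithms, so the bound 1 on reciprocity suffices. *)
Lemma payoff_le_supercritical (e : R) : 0 < e < 1 ->
  exists2 K : R, 0 < K & forall n (r : grid k n -> R) u, (2 <= n)%N ->
    k%:R + e <= r u -> payoff alpha r u <= K * welfare_scale n.
Proof.
move=> /andP[e0 e1].
have k1 : 1 <= k%:R :> R by rewrite ler1n.
have s0 : 0 <= k%:R + e - 1 < k%:R.
  by apply/andP; split; lra.
have [C C0 CS] := norm_const_le_powR k0 s0.
have [D D0 DL] := powRN_le_ln (addr_gt0 a0 ltr01) (mulr_gt0 e0 a0).
exists (C `^ alpha * D); first by rewrite mulr_gt0 ?powR_gt0.
move=> n r u n2 ru; have n0 : (0 < n)%N by lia.
have mru : mean_dist u (r u) <= C * n%:R `^ (1 - e).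
  have -> : 1 - e = k%:R - (k%:R + e - 1) by ring.
  apply: le_trans (CS n u n0); rewrite mean_distE.
  apply: (@le_trans _ _ (norm_const u (r u - 1))); last first.
    by apply: norm_const_anti; rewrite lerD2r.
  rewrite ler_pdivrMr ?norm_const_gt0// ler_peMr ?norm_const_ge0//.
  exact: norm_const_ge1 (Ordinal k0) _ _ n2.
apply: (@le_trans _ _ ((C * n%:R `^ (1 - e)) `^ alpha)).
  rewrite -[leRHS]mulr1; apply: ler_pM.
  - exact: powR_ge0.
  - exact: reciprocity_ge0.
  - apply: ge0_ler_powR; rewrite ?(ltW a0)// nnegrE ?mean_dist_ge0//.
    by rewrite mulr_ge0 ?powR_ge0 ?ltW.
  exact: reciprocity_le1.
rewrite powRM ?powR_ge0 ?(ltW C0)// -powRrM mulrBl mul1r powRD; last first.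
  by rewrite pnatr_eq0 -lt0n n0 implybT.
rewrite -mulrA ler_wpM2l ?powR_ge0//.
by rewrite [leRHS]mulrCA ler_wpM2l ?powR_ge0// DL.
Qed.

Lemma social_welfare_le (g : nat) : (2 <= g)%N ->
  exists2 K : R, 0 < K & forall n (r : grid k n -> R), (2 <= n)%N ->
    profiles g%:R^-1 r ->
    social_welfare alpha r <= K * (welfare_scale n * (n ^ k)%:R).
Proof.
move=> g2; have g0 : 0 < g%:R :> R by rewrite ltr0n; lia.
have e0 : 0 < g%:R^-1 :> R by rewrite invr_gt0.
have e1 : g%:R^-1 < 1 :> R by rewrite invf_lt1// ltr1n.
have [|K1 K10 H1] := @payoff_le_subcritical g%:R^-1; first by rewrite e0 ltW.
have [K2 K20 H2] := payoff_le_critical.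
have [|K3 K30 H3] := @payoff_le_supercritical g%:R^-1; first by rewrite e0.
(* All three regimes are bounded through [incoming r u + 1], which sums to 2 n^k. *)
exists (2 * (K1 + K2 + K3)); first by rewrite mulr_gt0 ?addr_gt0.
move=> n r n2 rP.
apply: (@le_trans _ _ (\sum_(u : grid k n)
    ((K1 + K2 + K3) * welfare_scale n * (incoming r u + 1)))); last first.
  rewrite -mulr_sumr big_split/= sum_incoming// sumr_const card_ffun !card_ord.
  by rewrite le_eqVlt; apply/orP; left; apply/eqP; ring.
apply: ler_sum => u _; have B0 := welfare_scale_ge0 n.
have Q0 := incoming_ge0 r u.
have BQ0 : 0 <= welfare_scale n * incoming r u by rewrite mulr_ge0.
have [m _ mE] := rP u.
(* As r_u = m / g with [m] natural, m <> k g forces a gap of at least 1 / g from k. *)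
have [mk|mk|mk] := ltngtP m (k * g)%N.
- apply: le_trans (H1 n r u n2 _) _; last by nra.
  rewrite -mE divr_ge0 ?ler0n// lerBrDr -[X in _ + X]mul1r -mulrDl natr1.
  by rewrite ler_pdivrMr// -natrM ler_nat.
- apply: le_trans (H3 n r u n2 _) _; last by nra.
  rewrite -mE -[X in _ + X]mul1r ler_pdivlMr// mulrDl mulfVK ?lt0r_neq0//.
  by rewrite -natrM natr1 ler_nat.
- apply: le_trans (H2 n r u n2 _) _; last by nra.
  by rewrite -mE mk natrM mulfK// lt0r_neq0.
Qed.

End Bounds.

(** * Lower bound from the two-parity profile *)

Section LowerBound.
Context {R : realType} {k : nat} (k0 : (0 < k)%N) (alpha : R) (a0 : 0 < alpha).
Let i0 := Ordinal k0.

Lemma large_parity_class n : exists b : bool,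
  (n ^ k <= #|[pred u : grid k n | odd (u i0) == b]|.*2)%N.
Proof.
have := cardC [pred u : grid k n | odd (u i0) == true].
rewrite card_ffun !card_ord => cardT.
have [h|h] := leqP (n ^ k) (#|[pred u : grid k n | odd (u i0) == true]|.*2).
  by exists true.
exists false.
have -> : #|[pred u : grid k n | odd (u i0) == false]| =
    #|predC [pred u : grid k n | odd (u i0) == true]|.
  by apply: eq_card => u; rewrite !inE; case: (odd _).
by move: h; rewrite -cardT -!addnn ltn_add2l leq_add2r; exact: ltnW.
Qed.

Definition parity_profile (b : bool) n (u : grid k n) : R :=
  if odd (u i0) == b then k%:R else k.+1%:R.

(** One neighbour of the other parity suffices: [u] links to it with probability at least 1 / (C ln
    n), and it links back with probability at least 1 / D. *)
Lemma payoff_parity_profile : exists2 K : R, 0 < K &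
  forall n b (u : grid k n), (2 <= n)%N -> odd (u i0) == b ->
    K * welfare_scale alpha n <= payoff alpha (@parity_profile b n) u.
Proof.
have k1 : 1 <= k%:R :> R by rewrite ler1n.
have s0 : 0 <= k%:R - 1 :> R by rewrite subr_ge0.
have [c c0 cS] := norm_const_ge_powR k0 s0.
have [C C0 CS] := @norm_const_dim_le R k k0.
pose D : R := 4 ^+ k * 2.
have D0 : 0 < D by rewrite mulr_gt0 ?exprn_gt0.
(* Here S(k - 1) >= c n, S(k) <= C ln n and S(k + 1) <= D. *)
exists ((c / C) `^ alpha / C / D); first by rewrite !divr_gt0 ?powR_gt0 ?divr_gt0.
move=> n b u n2 ub; have n0 : (0 < n)%N by lia.
have L0 : 0 < ln n%:R :> R by exact: ln_nat_gt0.
have CL0 : 0 < C * ln n%:R by rewrite mulr_gt0.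
have ru : parity_profile b u = k%:R by rewrite /parity_profile ub.
have [v [vu uv1 /negP vb]] := torus_neighbor i0 u n2.
have rv : parity_profile b v = k.+1%:R.
  by rewrite /parity_profile; case: ifP => // /eqP vb'; case: vb; rewrite vb' eq_sym.
have mu : c / C * (n%:R / ln n%:R) <= mean_dist u k%:R.
  rewrite mean_distE mulrACA -invfM; apply: ler_pM.
  - by rewrite mulr_ge0 ?(ltW c0).
  - by rewrite invr_ge0 ltW.
  - by have := cS n u n2; rewrite subKr powRr1.
  by rewrite lef_pV2 ?posrE ?(norm_const_gt0 k0 n2) ?CS.
have rec : (C * ln n%:R)^-1 * D^-1 <= reciprocity (@parity_profile b n) u.
  rewrite /reciprocity (bigD1 v)//= ler_wpDr//.
    by apply: sumr_ge0 => w _; rewrite mulr_ge0 ?link_prob_ge0.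
  rewrite ru rv /link_prob (torus_distC v u) uv1 !powR1 !mul1r.
  apply: ler_pM; rewrite ?invr_ge0 ?(ltW CL0) ?(ltW D0)//.
    by rewrite lef_pV2 ?posrE ?(norm_const_gt0 k0 n2) ?CS.
  by rewrite lef_pV2 ?posrE ?(norm_const_gt0 k0 n2) ?norm_const_dimS_le.
rewrite /welfare_scale -powR_div_ln ?ltr1n//.
rewrite [leLHS](_ : _ = (c / C * (n%:R / ln n%:R)) `^ alpha *
    ((C * ln n%:R)^-1 * D^-1)); last first.
  rewrite [in RHS]powRM ?divr_ge0 ?(ltW c0) ?(ltW C0) ?(ltW L0)// (invfM C).
  by ring.
rewrite /payoff ru; apply: ler_pM => //.
- exact: powR_ge0.
- by rewrite mulr_ge0 ?invr_ge0 ?ltW.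
apply: ge0_ler_powR; rewrite ?nnegrE ?(ltW a0) ?mean_dist_ge0//.
by rewrite mulr_ge0 ?divr_ge0 ?(ltW c0) ?(ltW C0) ?(ltW L0).
Qed.

Lemma social_welfare_ge (g : nat) : (0 < g)%N ->
  exists2 K : R, 0 < K & forall n, (2 <= n)%N ->
    exists2 r : grid k n -> R, profiles g%:R^-1 r &
      K * (welfare_scale alpha n * (n ^ k)%:R) <= social_welfare alpha r.
Proof.
move=> g0; have [K K0 KP] := payoff_parity_profile.
exists (K / 2); first by rewrite divr_gt0.
move=> n n2; have [b bn] := large_parity_class n.
exists (@parity_profile b n).
  have mulgK m : (m * g)%:R * g%:R^-1 = m%:R :> R.
    by rewrite natrM mulfK// pnatr_eq0 -lt0n.
  move=> u; rewrite /parity_profile; case: ifP => _.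
    by exists (k * g)%N.
  by exists (k.+1 * g)%N.
rewrite /social_welfare (bigID [pred u : grid k n | odd (u i0) == b])/=.
(* The class playing k + 1 is discarded; the other one holds at least half of the nodes, whence K /
   2. *)
apply: ler_wpDr; first by apply: sumr_ge0 => u _; exact: payoff_ge0.
apply: (@le_trans _ _ (\sum_(u : grid k n | odd (u i0) == b) K * welfare_scale alpha n)).
  rewrite sumr_const -[leRHS]mulr_natr.
  rewrite [leLHS](_ : _ = K * welfare_scale alpha n * ((n ^ k)%:R / 2)); last by ring.
  apply: ler_wpM2l; first by rewrite mulr_ge0 ?(ltW K0) ?welfare_scale_ge0.
  by rewrite ler_pdivrMr// -natrM ler_nat muln2; exact: bn.
by apply: ler_sum => u ub; exact: KP.
Qed.
End LowerBound.

(** * From the two bounds to the optimal welfare *)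

Theorem theorem4p1 (R : realType) (k g : nat) (alpha : R)
  (hk : (1 <= k)%N) (hg : (2 <= g)%N) (halpha : 0 < alpha) :
  (fun n : nat => optimal_welfare k (g%:R^-1 : R) alpha n : R^o) \is
  'Theta_\oo (fun n : nat => n%:R `^ (alpha + k%:R) / ln n%:R `^ (alpha + 1) : R^o).
Proof.
have [K K0 KP] := social_welfare_ge hk halpha (ltnW hg).
have [C C0 CP] := social_welfare_le hk halpha hg.
apply/asboolP; exists (K, C) => /=; first by rewrite K0 C0.
near=> n; have n2 : (2 <= n)%N by near: n; exact: nbhs_infty_ge.
have scaleE : n%:R `^ (alpha + k%:R) / ln n%:R `^ (alpha + 1) =
    welfare_scale alpha n * (n ^ k)%:R.
  rewrite powRD; last by rewrite pnatr_eq0 -lt0n (ltnW n2) implybT.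
  by rewrite powR_mulrn// -natrX mulrAC.
have scale0 : 0 <= welfare_scale alpha n * (n ^ k)%:R.
  by rewrite mulr_ge0 ?welfare_scale_ge0.
have [r rP rK] := KP n n2.
have lower : K * (welfare_scale alpha n * (n ^ k)%:R) <=
    optimal_welfare k g%:R^-1 alpha n.
  (* A value is below the supremum only if the set is bounded above, so the upper bound on the
     welfare enters here too. *)
  apply: le_trans rK _; apply: ub_le_sup; last by exists r.
  exists (C * (welfare_scale alpha n * (n ^ k)%:R)) => _ [s sP <-].
  exact: CP.
have upper : optimal_welfare k g%:R^-1 alpha n <=
    C * (welfare_scale alpha n * (n ^ k)%:R).
  (* The profile [r] of the lower bound shows that the set of welfares is nonempty. *)
  apply: ge_sup; first by exists (social_welfare alpha r), r.
  by move=> _ [s sP <-]; exact: CP.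
rewrite scaleE (ger0_norm scale0) ger0_norm//.
by apply: le_trans lower; rewrite mulr_ge0// ltW.
Unshelve. all: by end_near.
Qed.
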